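(* Let $K_\Omega>0$, $b>0$ and $R_J>1$. If $b\ge1$ then $$\Lambda=\frac1{K_\Omega+1}.$$
   Context: $\Omega\subset\mathbb{R}^N$ is a bounded connected domain with $C^{1,\alpha}$ boundary. The kernel $J\colon\mathbb{R}^N\to\mathbb{R}$ is radially symmetric, nonnegative, continuous, compactly supported, with $J(0)>0$ and $\int_{\mathbb{R}^N}J(x)\,dx=1$. Let $R_J=\inf\{R: J(x)=0 \text{ in } \mathbb{R}^N\setminus B(0,R)\}\in(0,\infty)$ and assume $J(x)>0$ for $|x|<R_J$. Functions in $W^{1,\infty}_0(\Omega)$ are extended by $0$ to $\mathbb{R}^N\setminus\Omega$; $[u]_J=\sup\{|u(x)-u(y)|: x,y\in\mathbb{R}^N,\ x-y\in\operatorname{supp}(J)\}$ and $$\Lambda=\inf\left\{\frac{\max\{\|\nabla u\|_\infty,[u]_J\}}{\|u\|_\infty}: u\in W^{1,\infty}_0(\Omega)\setminus\{0\}\right\}.$$ The inradius is $R_\Omega=\max\{\operatorname{dist}(x,\partial\Omega): x\in\overline{\Omega}\}$, and $K_\Omega\in\mathbb{N}\cup\{0\}$, $b\in[0,R_J)$ are the quotient and remainder defined by $R_\Omega=K_\Omega R_J+b$. *)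

(* Defs.v *)
From HB Require Import structures.
From mathcomp Require Import all_boot all_order all_algebra.
From mathcomp Require Import all_classical all_reals all_analysis.

Set Implicit Arguments.
Unset Strict Implicit.
Unset Printing Implicit Defensive.

Import Order.TTheory GRing.Theory Num.Theory.
Import numFieldNormedType.Exports.

Local Open Scope classical_set_scope.
Local Open Scope ring_scope.

(* R^N is 'rV[R]_N.  The norm `|x| of the library is the sup norm there: it is
   used only through the topology and bounded_set, which do not depend on the
   choice of the norm.  Every metric notion below uses enorm. *)
Section euclidean.
Context {R : realType} {N : nat}.
Implicit Types (x y : 'rV[R]_N) (A : set 'rV[R]_N).

Definition edot x y : R := \sum_i x ord0 i * y ord0 i.

Definition enorm x : R := Num.sqrt (edot x x).

Definition eball (x : 'rV[R]_N) (r : R) : set 'rV[R]_N :=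
  [set y | enorm (y - x) < r].

Definition edist_to A x : R := inf [set enorm (x - y) | y in A].

Definition boundary A : set 'rV[R]_N := closure A `\` interior A.

Definition tsupp (f : 'rV[R]_N -> R) : set 'rV[R]_N :=
  closure [set x | f x != 0].

Definition partial (i : 'I_N) (f : 'rV[R]_N -> R) : 'rV[R]_N -> R :=
  fun x => 'D_(delta_mx ord0 i) f x.

Definition grad (f : 'rV[R]_N -> R) : 'rV[R]_N -> 'rV[R]_N :=
  fun x => \row_i partial i f x.

End euclidean.

(* The sigma-algebra on R^N generated by the coordinates, i.e. the product of
   the Borel sigma-algebras, which is the Borel sigma-algebra of R^N. *)
Definition measure_rV_display : measure_display.
Proof. exact: default_measure_display. Qed.

Section measurable_rV.
Context {R : realType}.
Variable n : nat.

Let coors : 'I_n -> 'rV[R]_n -> R := fun i x => x ord0 i.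

Let rV_set0 : g_sigma_preimage coors set0.
Proof. exact: sigma_algebra0. Qed.

Let rV_setC A : g_sigma_preimage coors A -> g_sigma_preimage coors (~` A).
Proof. exact: sigma_algebraC. Qed.

Let rV_bigcup (F : _^nat) : (forall i, g_sigma_preimage coors (F i)) ->
  g_sigma_preimage coors (\bigcup_i (F i)).
Proof. exact: sigma_algebra_bigcup. Qed.

HB.instance Definition _ :=
  @isMeasurable.Build measure_rV_display
    'rV[R]_n (g_sigma_preimage coors) rV_set0 rV_setC rV_bigcup.

End measurable_rV.

Section measurable_rV_theory.
Context {R : realType}.

Lemma measurable_coord n (i : 'I_n) :
  measurable_fun [set: 'rV[R]_n] (fun x : 'rV[R]_n => x ord0 i).
Proof.
move=> _ Y mY; rewrite setTI; apply: sub_sigma_algebra => /=.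
rewrite -bigcup_seq/=; exists i => /=; first by rewrite mem_index_enum.
by exists Y => //; rewrite setTI.
Qed.

Lemma measurable_fun_rVP d (T : measurableType d) n (f : T -> 'rV[R]_n) :
  (forall i, measurable_fun [set: T] (fun x => f x ord0 i)) ->
  measurable_fun [set: T] f.
Proof.
move=> mf _ A mA; rewrite setTI.
pose S := [set B : set 'rV[R]_n | measurable (f @^-1` B)].
suff : S A by [].
apply: (smallest_sub _ _ mA) => /=.
  split.
  - by rewrite /S/= preimage_set0.
  - move=> B; rewrite /S/= setTD => mB.
    by rewrite -preimage_setC; exact: measurableC.
  - by move=> F mF; rewrite /S/= preimage_bigcup; exact: bigcupT_measurable.
rewrite -bigcup_seq => B [i _ [C mC <-]]; rewrite /S/= setTI.
by have := mf i measurableT C mC; rewrite setTI.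
Qed.

Definition rV_cons n (p : 'rV[R]_n * measurableTypeR R) : 'rV[R]_n.+1 :=
  row_mx ((p.2 : R)%:M : 'rV_1) p.1.

Lemma measurable_rV_cons n : measurable_fun setT (@rV_cons n).
Proof.
apply: measurable_fun_rVP => i; rewrite /rV_cons.
have [k ->] : exists k, i = @unsplit 1 n k.
  by exists (@fintype.split 1 n i); rewrite (@fintype.splitK 1 n).
case: k => j.
  have -> : (fun x : 'rV[R]_n * measurableTypeR R =>
      row_mx ((x.2 : R)%:M : 'rV_1) x.1 ord0 (lshift n j)) = snd.
    by apply/funext => x; rewrite row_mxEl mxE (ord1 j) eqxx.
  exact: measurable_snd.
have -> : (fun x : 'rV[R]_n * measurableTypeR R =>
    row_mx ((x.2 : R)%:M : 'rV_1) x.1 ord0 (rshift 1 j)) =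
    (fun y : 'rV[R]_n => y ord0 j) \o fst.
  by apply/funext => x; rewrite row_mxEr.
exact: (measurableT_comp (measurable_coord j) measurable_fst).
Qed.

End measurable_rV_theory.

Section lebesgue_rV.
Context {R : realType}.

Definition leb_cons n (mu : {measure set 'rV[R]_n -> \bar R}) :
    set 'rV[R]_n.+1 -> \bar R :=
  pushforward (mu \x lebesgue_measure)%E (@rV_cons R n).

HB.instance Definition _ n (mu : {measure set 'rV[R]_n -> \bar R}) :=
  Measure.copy (leb_cons mu)
    (measure_function_pushforward__canonical__measure_function_Measure
       (mu \x lebesgue_measure)%E (@measurable_rV_cons R n)).

(* N-dimensional Lebesgue measure, as the N-fold product of the
   one-dimensional one. *)
Fixpoint leb n : {measure set 'rV[R]_n -> \bar R} :=
  match n with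
  | 0 => \d_(0 : 'rV[R]_0)
  | m.+1 => leb_cons (leb m)
  end.

End lebesgue_rV.

Section domains.
Context {R : realType} {N : nat}.
Implicit Types (Omega : set 'rV[R]_N) (gamma : 'rV[R]_N -> R).

Definition C1alpha (alpha : R) gamma :=
  (forall x, differentiable gamma x) /\
  exists C : R, forall x y,
    enorm (grad gamma x - grad gamma y) <= C * enorm (x - y) `^ alpha.

(* In a ball around each of its points, the boundary is a C^{1,alpha} graph
   over the hyperplane orthogonal to a unit vector nu, with Omega strictly
   above the graph.  The function gamma is only evaluated on that hyperplane,
   as p - (p . nu) nu is the orthogonal projection of p on it. *)
Definition C1alpha_boundary (alpha : R) Omega :=
  forall x0, boundary Omega x0 ->
  exists (r : R) (nu : 'rV[R]_N) gamma,
    [/\ 0 < r, enorm nu = 1, C1alpha alpha gamma &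
        forall x, eball x0 r x ->
          let p := x - x0 in
          Omega x <-> gamma (p - edot p nu *: nu) < edot p nu].

Record bounded_C1alpha_domain (alpha : R) Omega : Prop := {
  domain_nonempty : Omega !=set0;
  domain_open : open Omega;
  domain_connected : connected Omega;
  domain_bounded : bounded_set Omega;
  domain_boundary : C1alpha_boundary alpha Omega }.

Definition inradius Omega : R :=
  sup [set edist_to (boundary Omega) x | x in closure Omega].

End domains.

Section kernels.
Context {R : realType} {N : nat}.
Implicit Types (J u : 'rV[R]_N -> R).

Definition kernel_radius J : R :=
  inf [set r | forall x, ~ eball 0 r x -> J x = 0].

Record admissible_kernel J : Prop := {
  kernel_radial : forall x y, enorm x = enorm y -> J x = J y;
  kernel_ge0 : forall x, 0 <= J x;
  kernel_continuous : continuous J;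
  kernel_compact_support : compact (tsupp J);
  kernel_gt0_at0 : 0 < J 0;
  kernel_mass : (\int[leb N]_x (J x)%:E = 1)%E;
  kernel_gt0 : forall x, enorm x < kernel_radius J -> 0 < J x }.

Definition jump_seminorm J u : R :=
  sup [set d | exists x y, tsupp J (x - y) /\ d = `|u x - u y|].

End kernels.

Section sobolev.
Context {R : realType} {N : nat}.
Implicit Types (Omega : set 'rV[R]_N) (u phi : 'rV[R]_N -> R)
  (g : 'rV[R]_N -> 'rV[R]_N).

Fixpoint Ck (k : nat) phi : Prop :=
  match k with
  | 0 => continuous phi
  | m.+1 => (forall x, differentiable phi x) /\
            forall i, Ck m (partial i phi)
  end.

Definition test_function Omega phi :=
  [/\ forall k, Ck k phi, compact (tsupp phi) & tsupp phi `<=` Omega].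

Definition Linfty_norm Omega u : \bar R :=
  'N[leb N]_+oo[EFin \o (u \_ Omega)].

Definition Linfty Omega u :=
  measurable_fun Omega u /\ (Linfty_norm Omega u < +oo)%E.

Definition weak_gradient Omega u g :=
  forall phi, test_function Omega phi -> forall i,
    \int[leb N]_(x in Omega) (u x * partial i phi x) =
    - \int[leb N]_(x in Omega) (g x ord0 i * phi x).

(* g is the weak gradient in Omega of u \in W^{1,infty}(Omega); it is unique
   up to a null set. *)
Definition W1infty_grad Omega u g :=
  [/\ Linfty Omega u, forall i, Linfty Omega (fun x => g x ord0 i) &
      weak_gradient Omega u g].

(* W^{1,infty}(Omega) with zero boundary values: u stands for the continuous
   representative, extended by 0 outside Omega. *)
Definition W1infty0_grad Omega u g :=
  [/\ W1infty_grad Omega u g, continuous u & forall x, ~ Omega x -> u x = 0].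

Definition Lambda Omega (J : 'rV[R]_N -> R) : R :=
  inf [set q | exists u g,
    [/\ W1infty0_grad Omega u g, exists x, u x != 0 &
        q = Num.max (fine (Linfty_norm Omega (enorm \o g))) (jump_seminorm J u)
            / fine (Linfty_norm Omega u)]].

End sobolev.

(* Main.v *)
Require Import Defs.
From HB Require Import structures.
From mathcomp Require Import all_boot all_order all_algebra.
From mathcomp Require Import all_classical all_reals all_analysis.
From mathcomp Require Import measurable_realfun ess_sup_inf ring lra.

Set Implicit Arguments.
Unset Strict Implicit.
Unset Printing Implicit Defensive.

Import Order.TTheory GRing.Theory Num.Theory.
Import numFieldNormedType.Exports.

Local Open Scope classical_set_scope.
Local Open Scope ring_scope.

(** Write [r] for the kernel radius, so that the inradius is [K * r + b] with
    [1 <= b < r]. The kernel is positive on the open ball of radius [r], so the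
    jump seminorm bounds the variation of [u] over one step of length less
    than [r] ([walk_le_jump_seminorm]).

    Lower bound. The inradius is less than [(K + 1) * r], so each point of
    [Omega] is at distance less than [(K + 1) * r] from some boundary point,
    where [u] vanishes ([near_boundary]). Walking there in [K + 1] equal steps
    gives [|u| <= (K + 1) * [u]_J], hence a quotient of at least
    [1 / (K + 1)] ([quotient_lower_bound]).

    Upper bound. On a ball of radius almost [K * r + 1] inside [Omega], take a
    radial staircase that climbs by [1 / (K + 1)] over a distance 1, stays
    flat over the distance [r - 1], and so on; the last climb reaches the
    centre, because [b >= 1]. Its slope is [1 / (K + 1)], and a step of length
    [r] meets at most one full climb, so its jump seminorm is [1 / (K + 1)] as
    well, while its maximum is 1. To stay within classical calculus, the
    staircase is made C^1 by rounding its corners with a parameter [d], and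
    the distance to the centre is replaced by [smooth_norm]. The rounded slope
    is [1 / ((K + 1) * (1 - 2 * d))] ([bump_quotient]), and [d] tends to 0.

    Admissibility of this test function requires integration by parts. For
    C^1 functions with bounded support it amounts to the fact that a partial
    derivative has integral zero, which follows from Fubini's theorem and the
    fundamental theorem of calculus by induction on the dimension
    ([integral_partial_eq0]). Finally, essential suprema are pointwise suprema
    for continuous functions since non-empty open sets have positive measure
    ([normr_le_Linfty_norm]). *)

(** * Continuity of pointwise operations *)

Section pointwise_continuity.
Context {R : realType} {T : topologicalType}.
Implicit Types f g : T -> R.

Lemma continuous_add f g :
  continuous f -> continuous g -> continuous (fun t => f t + g t).
Proof. by move=> cf cg t; apply: cvgD; [exact: cf|exact: cg]. Qed.

Lemma continuous_mul f g :
  continuous f -> continuous g -> continuous (fun t => f t * g t).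
Proof. by move=> cf cg t; apply: cvgM; [exact: cf|exact: cg]. Qed.

Lemma continuous_compose (U V : topologicalType) (f : T -> U) (g : U -> V) :
  continuous f -> continuous g -> continuous (fun t => g (f t)).
Proof. by move=> cf cg t; apply: continuous_comp; [exact: cf|exact: cg]. Qed.

End pointwise_continuity.

(** * Euclidean geometry *)

Section euclidean_space.
Context {R : realType} {N : nat}.
Implicit Types x y z v : 'rV[R]_N.

Lemma edotC x y : edot x y = edot y x.
Proof. by apply: eq_bigr => i _; rewrite mulrC. Qed.

Lemma edotDl x y z : edot (x + y) z = edot x z + edot y z.
Proof. by rewrite -big_split; apply: eq_bigr => i _; rewrite mxE mulrDl. Qed.

Lemma edotZl a x y : edot (a *: x) y = a * edot x y.
Proof. by rewrite /edot mulr_sumr; apply: eq_bigr => i _; rewrite mxE mulrA. Qed.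

Lemma edotDr x y z : edot z (x + y) = edot z x + edot z y.
Proof. by rewrite edotC edotDl !(edotC z). Qed.

Lemma edotZr a x y : edot x (a *: y) = a * edot x y.
Proof. by rewrite edotC edotZl edotC. Qed.

Lemma edot_ge0 x : 0 <= edot x x.
Proof. by apply: sumr_ge0 => i _; rewrite -expr2 sqr_ge0. Qed.

Lemma sqr_coord_le_edot x i : x ord0 i ^+ 2 <= edot x x.
Proof.
rewrite /edot (bigD1 i)//= -expr2 lerDl; apply: sumr_ge0 => j _.
by rewrite -expr2 sqr_ge0.
Qed.

Lemma edot_delta x i : edot x (delta_mx ord0 i) = x ord0 i.
Proof.
rewrite /edot (bigD1 i)//= mxE !eqxx mulr1 big1 ?addr0// => j ji.
by rewrite mxE (negbTE ji) andbF mulr0.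
Qed.

Lemma edot_eq0 x : edot x x = 0 -> x = 0.
Proof.
move=> x0; apply/rowP => i; rewrite mxE; apply/eqP.
by rewrite -sqrf_eq0 eq_le sqr_ge0 -x0 sqr_coord_le_edot.
Qed.

(** Cauchy-Schwarz inequality. *)
Lemma sqr_edot_le x y : edot x y ^+ 2 <= edot x x * edot y y.
Proof.
have [y0|y0] := eqVneq (edot y y) 0.
  have -> : y = 0 by exact: edot_eq0.
  by rewrite -(scale0r x) !edotZr !mul0r mulr0 expr0n.
have yp : 0 < edot y y by rewrite lt_def y0 edot_ge0.
(* squared length of (y . y) x - (x . y) y, the projection of x orthogonal to
   y up to a factor y . y *)
have := edot_ge0 (edot y y *: x + (- edot x y) *: y).
rewrite !(edotDl, edotDr, edotZl, edotZr) (edotC y x).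
set a := edot y y in y0 yp *; set b := edot x y; set c := edot x x.
rewrite [X in 0 <= X -> _](_ : _ = a * (c * a - b ^+ 2)); last by ring.
by rewrite pmulr_rge0// subr_ge0.
Qed.

(** For [eta > 0] this is a smooth substitute for the Euclidean norm, which it
    exceeds by at most [eta]; it is the norm of [(x, eta)] in one more
    dimension. *)
Definition smooth_norm (eta : R) x : R := Num.sqrt (edot x x + eta ^+ 2).

Lemma smooth_norm0 x : smooth_norm 0 x = enorm x.
Proof. by rewrite /smooth_norm expr0n addr0. Qed.

Lemma smooth_norm_at0 eta : 0 <= eta -> smooth_norm eta 0 = eta.
Proof.
by move=> e0; rewrite /smooth_norm -(scale0r 0) edotZl mul0r add0r sqrtr_sqr ger0_norm.
Qed.

Lemma sqr_smooth_norm eta x : smooth_norm eta x ^+ 2 = edot x x + eta ^+ 2.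
Proof. by rewrite sqr_sqrtr// addr_ge0 ?edot_ge0 ?sqr_ge0. Qed.

Lemma smooth_norm_gt0 eta x : 0 < eta -> 0 < smooth_norm eta x.
Proof.
by move=> e0; rewrite sqrtr_gt0 ltr_wpDl ?edot_ge0// exprn_gt0.
Qed.

Lemma enorm_ge0 x : 0 <= enorm x. Proof. exact: sqrtr_ge0. Qed.

Lemma sqr_enorm x : enorm x ^+ 2 = edot x x.
Proof. by rewrite sqr_sqrtr// edot_ge0. Qed.

Lemma enorm_le_smooth_norm eta x : enorm x <= smooth_norm eta x.
Proof. by rewrite ler_wsqrtr// lerDl sqr_ge0. Qed.

Lemma edot_le_enorm x y : edot x y <= enorm x * enorm y.
Proof.
rewrite (le_trans (ler_norm _))//.
rewrite -(@ler_pXn2r _ 2)// ?nnegrE ?mulr_ge0 ?enorm_ge0//.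
by rewrite real_normK ?num_real// exprMn !sqr_enorm sqr_edot_le.
Qed.

(** The triangle inequality in one more dimension, between [(x, eta)] and
    [(y, 0)]. *)
Lemma smooth_normD eta x y :
  smooth_norm eta (x + y) <= smooth_norm eta x + enorm y.
Proof.
rewrite -(@ler_pXn2r _ 2)// ?nnegrE ?addr_ge0 ?enorm_ge0 ?sqrtr_ge0//.
rewrite sqr_smooth_norm sqrrD sqr_smooth_norm sqr_enorm edotDl !edotDr (edotC y x).
have := edot_le_enorm x y.
have := ler_wpM2r (enorm_ge0 y) (enorm_le_smooth_norm eta x).
by move=> ? ?; lra.
Qed.

Lemma enormD x y : enorm (x + y) <= enorm x + enorm y.
Proof. by have := smooth_normD 0 x y; rewrite !smooth_norm0. Qed.

Lemma enormZ a x : enorm (a *: x) = `|a| * enorm x.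
Proof.
by rewrite /enorm edotZl edotZr mulrA -expr2 sqrtrM ?sqr_ge0// sqrtr_sqr.
Qed.

Lemma enormN x : enorm (- x) = enorm x.
Proof. by rewrite -scaleN1r enormZ normrN1 mul1r. Qed.

Lemma enormB x y : enorm (x - y) = enorm (y - x).
Proof. by rewrite -opprB enormN. Qed.

Lemma enorm0 : enorm (0 : 'rV[R]_N) = 0.
Proof. by rewrite -(scale0r 0) enormZ normr0 mul0r. Qed.

Lemma coord_le_enorm x i : `|x ord0 i| <= enorm x.
Proof.
rewrite -(@ler_pXn2r _ 2)// ?nnegrE ?enorm_ge0//.
by rewrite real_normK ?num_real// sqr_enorm sqr_coord_le_edot.
Qed.

Lemma smooth_norm_lipschitz eta x y :
  `|smooth_norm eta x - smooth_norm eta y| <= enorm (x - y).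
Proof.
rewrite ler_norml; apply/andP; split.
  have := smooth_normD eta x (y - x); rewrite addrC subrK enormB; lra.
by have := smooth_normD eta y (x - y); rewrite addrC subrK; lra.
Qed.

Lemma continuous_rV (T : topologicalType) (f : T -> 'rV[R]_N) :
  (forall i, continuous (fun t => f t ord0 i)) -> continuous f.
Proof.
move=> cf t A [P tP PA].
rewrite /nbhs/=; have : \forall s \near t, forall i, P ord0 i (f s ord0 i).
  by apply: filter_forall => i; apply: cf; exact: tP.
by apply: filterS => s sP; apply: PA => i j; rewrite (ord1 i).
Qed.

Lemma continuous_sum (T : topologicalType) (I : Type) (r : seq I) (f : I -> T -> R) :
  (forall i, continuous (f i)) -> continuous (fun t => \sum_(i <- r) f i t).
Proof.
move=> cf; elim: r => [|i r IH].
  rewrite (_ : (fun _ => _) = cst 0); last by apply/funext => s; rewrite big_nil.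
  by move=> t; exact: cvg_cst.
rewrite (_ : (fun _ => _) = fun s => f i s + \sum_(j <- r) f j s); last first.
  by apply/funext => s; rewrite big_cons.
exact: continuous_add.
Qed.

Lemma continuous_smooth_norm eta : continuous (smooth_norm eta).
Proof.
apply: (@continuous_compose _ _ _ (fun x => edot x x + eta ^+ 2) (@Num.sqrt R));
  last exact: sqrt_continuous.
apply: continuous_add; last by move=> x; exact: cst_continuous.
apply: continuous_sum => i; apply: continuous_mul; exact: coord_continuous.
Qed.

Lemma continuous_enorm : continuous (@enorm R N).
Proof.
have -> : @enorm R N = smooth_norm 0 by apply/funext => x; rewrite smooth_norm0.
exact: continuous_smooth_norm.
Qed.

Lemma normr_rV_leP x M :
  0 <= M -> (`|x| <= M) <-> (forall i, `|x ord0 i| <= M).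
Proof.
move=> M0; have -> : `|x| = mx_norm x by [].
rewrite mx_normrE; split=> [/bigmax_leP[_ H] i|H]; first exact: (H (ord0, i)).
by apply: bigmax_le => // -[j i] _ /=; rewrite (ord1 j).
Qed.

(** [bounded_set] refers to the sup norm, all distances to the Euclidean one. *)
Lemma bounded_enorm (A : set 'rV[R]_N) : bounded_set A ->
  exists2 M, 0 < M & forall x, A x -> enorm x <= M.
Proof.
move=> [C [_ /(_ (`|C| + 1))]]; rewrite (le_lt_trans (ler_norm _)) ?ltrDl//.
move=> /(_ isT) HA; pose M := `|C| + 1.
have M0 : 0 <= M by rewrite addr_ge0.
exists (Num.sqrt (N%:R * M ^+ 2) + 1).
  by apply: ltr_wpDl; [exact: sqrtr_ge0|exact: ltr01].
move=> x /HA /= xM; rewrite (@le_trans _ _ (Num.sqrt (N%:R * M ^+ 2))) ?lerDl//.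
rewrite ler_wsqrtr// /edot (@le_trans _ _ (\sum_(i < N) M ^+ 2))//; last first.
  by rewrite sumr_const card_ord mulr_natl.
apply: ler_sum => i _; rewrite -expr2 -(real_normK (num_real _)).
rewrite lerXn2r ?nnegrE//.
by move: xM => /(normr_rV_leP _ M0).
Qed.

End euclidean_space.
(** * Inradius *)

Section inradius.
Context {R : realType} {N : nat}.
Implicit Types (Omega A : set 'rV[R]_N) (x y z : 'rV[R]_N).

Lemma continuous_segment x y : continuous (fun t : R => x + t *: (y - x)).
Proof.
apply: continuous_rV => i.
rewrite (_ : (fun _ => _) = fun t => x ord0 i + t * (y - x) ord0 i); last first.
  by apply/funext => t; rewrite !mxE.
apply: continuous_add; first by move=> t; exact: cvg_cst.
by apply: continuous_mul => t; [exact: cvg_id|exact: cvg_cst].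
Qed.

(** The supremum of the times that the segment spends in [Omega] is the time
    of a boundary point: it is a limit of times in [Omega], and by openness it
    cannot be one of them. *)
Lemma segment_meets_boundary Omega x y : open Omega -> Omega x -> ~ Omega y ->
  exists2 t : R, 0 <= t <= 1 & boundary Omega (x + t *: (y - x)).
Proof.
move=> oO Ox nOy; pose c t := x + t *: (y - x).
pose A := [set t : R | 0 <= t <= 1 /\ Omega (c t)].
have A0 : A 0 by split; [rewrite lexx ler01|rewrite /c scale0r addr0].
have hsA : has_sup A by split; [exists 0|exists 1 => t [/andP[]]].
have s0 : 0 <= sup A by exact: sup_upper_bound.
have s1 : sup A <= 1 by apply: ge_sup; [exists 0|move=> t [/andP[]]].
exists (sup A); first by rewrite s0.
split.
  move=> B; move/(@continuous_segment x y (sup A)) => -[e /= e0 eB].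
  have [t At st] := sup_adherent e0 hsA.
  exists (c t); split; first by case: At.
  apply: eB => /=.
  by have ts := sup_upper_bound hsA At; rewrite ger0_norm ?subr_ge0//; lra.
rewrite -/(c _) => /interior_subset Os.
have {}s1 : sup A < 1.
  rewrite lt_neqAle s1 andbT; apply/eqP => s1'; apply: nOy.
  by move: Os; rewrite /c s1' scale1r addrC subrK.
have : nbhs (c (sup A)) Omega by move: oO; rewrite openE; exact.
move/(@continuous_segment x y (sup A)) => -[e /= e0 eO].
pose t := Num.min 1 (sup A + e / 2).
have st : sup A < t by rewrite lt_min s1/= ltrDl divr_gt0.
have te : t <= sup A + e / 2 by rewrite ge_min lexx orbT.
suff /(sup_upper_bound hsA) : A t by rewrite leNgt st.
split; first by rewrite (le_trans s0 (ltW st))/= ge_min lexx.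
apply: eO => /=; rewrite distrC ger0_norm ?subr_ge0 ?ltW//.
by lra.
Qed.

Lemma closed_enorm_ball (M : R) : closed [set x : 'rV[R]_N | enorm x <= M].
Proof.
apply: (@closed_comp _ _ (@enorm R N) [set t : R | t <= M]).
  by move=> x _; exact: continuous_enorm.
exact: closed_le.
Qed.

Lemma closure_enorm_le A (M : R) : (forall x, A x -> enorm x <= M) ->
  forall x, closure A x -> enorm x <= M.
Proof.
move=> AM; have := @closure_subset _ A [set x | enorm x <= M] AM.
rewrite -(closure_id [set x | enorm x <= M]).1 => [H x /H//|]; exact: closed_enorm_ball.
Qed.

Lemma edist_to_le A x z : A z -> edist_to A x <= enorm (x - z).
Proof.
move=> Az; apply: ge_inf; last by exists z.
by exists 0 => _ [y _ <-]; exact: enorm_ge0.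
Qed.

Variable Omega : set 'rV[R]_N.
Hypotheses (openO : open Omega) (boundedO : bounded_set Omega).

(** Any segment from [x] to a far away point crosses the boundary. Without a
    boundary point the distances to the boundary would be infima of the empty
    set. *)
Lemma bounded_boundary_nonempty x : (0 < N)%N -> Omega x ->
  boundary Omega !=set0.
Proof.
move=> N0 Ox; have [M M0 OM] := bounded_enorm boundedO.
have nO : ~ Omega (const_mx (M + 1)).
  move/OM; apply/negP; rewrite -ltNge.
  apply: lt_le_trans (coord_le_enorm _ (Ordinal N0)).
  by rewrite mxE ger0_norm; lra.
have [t _ bt] := segment_meets_boundary openO Ox nO.
by exists (x + t *: (const_mx (M + 1) - x)).
Qed.

Lemma has_sup_edist_boundary x : (0 < N)%N -> Omega x ->
  has_sup [set edist_to (boundary Omega) x | x in closure Omega].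
Proof.
move=> N0 Ox; have [z bz] := bounded_boundary_nonempty N0 Ox.
have [M M0 /closure_enorm_le OM] := bounded_enorm boundedO.
split; first by exists (edist_to (boundary Omega) x), x => //; exact: subset_closure.
exists (M + M) => _ [y cy <-]; apply: le_trans (edist_to_le _ bz) _.
apply: le_trans (enormD _ _) _; rewrite enormN.
by apply: lerD; [exact: OM|apply: OM; case: bz].
Qed.

Lemma near_boundary x (d : R) : (0 < N)%N -> Omega x -> inradius Omega < d ->
  exists2 z, ~ Omega z & enorm (z - x) < d.
Proof.
move=> N0 Ox Rd; have hs := has_sup_edist_boundary N0 Ox.
have : edist_to (boundary Omega) x < d.
  apply: le_lt_trans Rd; apply: (sup_upper_bound hs).
  by exists x => //; exact: subset_closure.
have [z bz] := bounded_boundary_nonempty N0 Ox.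
move=> /inf_lt[|_ [y [_ by_] <-] yd]; first by exists (enorm (x - z)), z.
by exists y; [move: openO by_ => /interior_id ->|rewrite enormB].
Qed.

(** A point of the ball outside [Omega] would give, on the segment from the
    centre, a boundary point too close to the centre. *)
Lemma ball_of_inradius (d : R) : (0 < N)%N -> Omega !=set0 ->
  0 <= d -> d < inradius Omega ->
  exists2 x, Omega x & forall y, enorm (y - x) <= d -> Omega y.
Proof.
move=> N0 [x0 Ox0] d0 dR; have hs := has_sup_edist_boundary N0 Ox0.
have [_ [x cx <-] dx] := sup_gt hs.1 dR.
have Ox : Omega x.
  apply: contrapT => nOx; have bx : boundary Omega x.
    by split => //; move/interior_subset.
  by have := edist_to_le x bx; rewrite subrr enorm0; lra.
exists x => // y yx; apply: contrapT => nOy.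
have [t /andP[t0 t1] /(edist_to_le x)] := segment_meets_boundary openO Ox nOy.
rewrite opprD addrA subrr sub0r enormN enormZ ger0_norm// => xt.
have := ler_piMl (enorm_ge0 (y - x)) t1.
by move=> ?; lra.
Qed.

End inradius.
(** * Lebesgue measure on row vectors *)

Section measurable_open.
Context {R : realType}.

(** Unlike Euclidean balls, cubes split as products along [rV_cons]
    ([cube_cons]), so that their measure is computed by induction. *)
Definition cube n (c : 'rV[R]_n) (e : R) : set 'rV[R]_n :=
  [set x | forall i, c ord0 i - e <= x ord0 i <= c ord0 i + e].

Lemma measurable_cube n (c : 'rV[R]_n) e : measurable (cube c e).
Proof.
rewrite (_ : cube c e = \bigcap_(i in [set: 'I_n])
    ((fun x : 'rV[R]_n => x ord0 i) @^-1` `[c ord0 i - e, c ord0 i + e])).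
  apply: fin_bigcap_measurable; first exact: finite_finset.
  move=> i _; rewrite -[X in measurable X]setTI.
  exact: (measurable_coord i).
apply/seteqP; split => x /=.
  by move=> H i _ /=; rewrite in_itv/=; exact: H.
by move=> H i; have := H i I; rewrite /= in_itv.
Qed.

Lemma nbhs_cube n (x : 'rV[R]_n) (A : set 'rV[R]_n) : nbhs x A ->
  exists2 e : R, 0 < e & cube x e `<=` A.
Proof.
move=> /nbhs_ballP[e /= e0 eA]; exists (e / 2); first by rewrite divr_gt0.
move=> y xy; apply: eA; split => // i j; rewrite (ord1 i) /ball/=.
by have /andP[? ?] := xy j; rewrite ltr_norml; apply/andP; split; lra.
Qed.

Lemma measurable_open n (A : set 'rV[R]_n) : open A -> measurable A.
Proof.
(* countable union of the cubes with rational centre and radius 1 / (k + 1)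
   that are contained in A *)
move=> oA.
pose C (qk : 'rV[rat]_n * nat) : set 'rV[R]_n :=
  cube (map_mx ratr qk.1) (qk.2.+1%:R^-1).
pose F qk := if `[< C qk `<=` A >] then C qk else set0.
rewrite (_ : A = \bigcup_qk F qk).
  apply: countable_bigcupT_measurable; first exact: countableP.
  move=> qk; rewrite /F; case: asboolP => _; last exact: measurable0.
  exact: measurable_cube.
apply/seteqP; split => [x Ax|x [qk _]]; last first.
  by rewrite /F; case: asboolP => // CA /CA.
have [e e0 eA] := nbhs_cube (open_nbhs_nbhs (conj oA Ax)).
have [k ke] : exists k : nat, k.+1%:R^-1 < e / 2.
  exists (Num.truncn (2 / e)).
  by rewrite invf_plt ?posrE ?divr_gt0// invf_div truncnS_gt.
have d0 : 0 < k.+1%:R^-1 :> R by rewrite invr_gt0.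
set d : R := k.+1%:R^-1 in ke d0 *.
have /choice[q qP] : forall i : 'I_n, exists q : rat,
    x ord0 i - d < ratr q < x ord0 i + d.
  move=> i; have [|q] := @rat_in_itvoo R (x ord0 i - d) (x ord0 i + d).
    lra.
  by rewrite in_itv/=; exists q.
have Cx : C (\row_i q i, k) x.
  by move=> i /=; rewrite !mxE -/d; have /andP[? ?] := qP i; apply/andP; split; lra.
exists (\row_i q i, k) => //; rewrite /F; case: asboolP => //; case.
move=> y Cy; apply: eA => i; have := Cx i; have := Cy i; rewrite /= !mxE -/d.
by move=> /andP[? ?] /andP[? ?]; apply/andP; split; lra.
Qed.

(** The sigma-algebra is generated by the coordinates, not by the open sets. *)
Lemma continuous_measurable n (f : 'rV[R]_n -> R) : continuous f ->
  measurable_fun setT f.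
Proof.
move=> /continuousP cf; apply: (measurability _ (RGenOpens.measurableE R)).
move=> _ [_ [a [b ->] <-]]; rewrite setTI.
by apply: measurable_open; apply: cf; exact: interval_open.
Qed.

Lemma rV_cons0 n (x : 'rV[R]_n * measurableTypeR R) :
  rV_cons x ord0 ord0 = x.2.
Proof.
have -> : ord0 = @lshift 1 n ord0 by exact/val_inj.
by rewrite /rV_cons [LHS](row_mxEl _ _ ord0 ord0) mxE eqxx.
Qed.

Lemma rV_consS n (x : 'rV[R]_n * measurableTypeR R) i :
  rV_cons x ord0 (lift ord0 i) = x.1 ord0 i.
Proof.
have -> : lift ord0 i = @rshift 1 n i by exact/val_inj.
by rewrite /rV_cons [LHS](row_mxEr _ _ ord0 i).
Qed.

Lemma cube_cons n (c : 'rV[R]_n.+1) e :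
  @rV_cons R n @^-1` cube c e =
  cube (\row_i c ord0 (lift ord0 i)) e `*` `[c ord0 ord0 - e, c ord0 ord0 + e].
Proof.
apply/seteqP; split => x /=.
  move=> H; split => [i|].
    by have := H (lift ord0 i); rewrite rV_consS mxE.
  by have := H ord0; rewrite rV_cons0 in_itv.
move=> [H1 H2] i; case: (unliftP ord0 i) => [j|] ->.
  by have := H1 j; rewrite rV_consS mxE.
by rewrite rV_cons0; move: H2; rewrite in_itv.
Qed.

Lemma leb_cube n (c : 'rV[R]_n) e : 0 < e -> leb n (cube c e) = ((2 * e) ^+ n)%:E.
Proof.
move=> e0; elim: n c => [|n IH] c.
  rewrite expr0 /= diracE mem_set// => -[].
  by [].
rewrite /= /leb_cons /pushforward cube_cons product_measure1E//; last first.
  exact: measurable_cube.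
rewrite IH exprSr EFinM; congr (_ * _)%E.
rewrite [LHS](lebesgue_measure_itv `[c ord0 ord0 - e, c ord0 ord0 + e])/=.
rewrite lte_fin ifT; last by lra.
by rewrite -EFinB; congr (_%:E); lra.
Qed.

End measurable_open.

(** * The essential supremum of a continuous function *)

Section Linfty_norm.
Context {R : realType} {N : nat}.
Implicit Types (Omega : set 'rV[R]_N) (u : 'rV[R]_N -> R).

Lemma cube_not_negligible (c : 'rV[R]_N) e : 0 < e ->
  ~ (leb N).-negligible (cube c e).
Proof.
move=> e0 /(negligibleP _ (measurable_cube c e)) c0.
have : leb N (cube c e) = 0%E by exact: c0.
by rewrite leb_cube// => -[] /eqP; rewrite gt_eqF// exprn_gt0// mulr_gt0.
Qed.

Lemma leb_setT_gt0 : (0 < leb N [set: 'rV[R]_N])%E.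
Proof.
rewrite lt0e measure_ge0 andbT; apply/negP => /eqP T0.
apply: (@cube_not_negligible 0 1) => //.
by exists setT; split => //; exact: measurableT.
Qed.

Lemma Linfty_normE Omega u :
  Linfty_norm Omega u = ess_sup (leb N) (fun x => `|(u \_ Omega) x|%:E).
Proof. by rewrite /Linfty_norm unlock leb_setT_gt0. Qed.

Lemma Linfty_norm_le Omega u (M : R) : (forall x, `|u x| <= M) ->
  (Linfty_norm Omega u <= M%:E)%E.
Proof.
move=> uM; rewrite Linfty_normE; apply: ess_sup_ler => x.
rewrite lee_fin patchE; case: ifPn => _; first exact: uM.
by rewrite normr0 (le_trans _ (uM x)).
Qed.

(** Non-empty open sets have positive measure, so a continuous function does not
    exceed its essential supremum anywhere. *)
Lemma normr_le_Linfty_norm Omega u x : open Omega -> continuous u -> Omega x ->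
  (`|u x|%:E <= Linfty_norm Omega u)%E.
Proof.
move=> oO cu Ox; rewrite leNgt; apply/negP => Lu.
have [m Lm mu] : exists2 m : R, (Linfty_norm Omega u <= m%:E)%E & m < `|u x|.
  case: (Linfty_norm Omega u) Lu => [r| |]//.
    by rewrite lte_fin => ru; exists r.
  by move=> _; exists (`|u x| - 1); [rewrite leNye|rewrite ltrBlDr ltrDl].
have : nbhs x [set y | Omega y /\ m < `|u y|].
  apply: filterI; first exact: open_nbhs_nbhs.
  have : `|u y| @[y --> x] --> `|u x| by exact: (cvg_norm (cu x)).
  by move/cvgr_gt; apply.
move=> /nbhs_cube[e e0 eO]; apply: (cube_not_negligible (c := x) e0).
have : (ess_sup (leb N) (fun x => `|(u \_ Omega) x|%:E) <= m%:E)%E.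
  by rewrite -Linfty_normE.
move=> /ess_supP; apply: negligibleS => y /eO[Oy muy] /=.
by rewrite patchE mem_set// lee_fin leNgt muy.
Qed.

End Linfty_norm.
(** * A smooth staircase *)

Section staircase.
Context {R : realType}.
Implicit Types (a t h : R) (f : R -> R).

(** Covers all functions differentiated by hand below: polynomials of degree
    at most 2, and the squared positive part, which is not smooth. *)
Lemma is_derive_quadratic_error f t (df C : R) :
  (forall h, `|f (t + h) - f t - h * df| <= C * h ^+ 2) -> is_derive t 1 f df.
Proof.
move=> fC.
have H : h^-1 *: (f (h *: 1 + t) - f t) @[h --> 0^'] --> df.
  apply/cvgrPdist_le => e e0.
  exists (e / (`|C| + 1)); first by rewrite /= divr_gt0// ltr_wpDl.
  move=> h /=; rewrite sub0r normrN => he h0.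
  have -> : df - h^-1 *: (f (h *: 1 + t) - f t) =
      - (h^-1 * (f (t + h) - f t - h * df)).
    by rewrite /GRing.scale/= mulr1 (addrC h t); field.
  have nh0 : 0 < `|h| by rewrite normr_gt0.
  rewrite normrN normrM normfV mulrC ler_pdivrMr//.
  apply: le_trans (fC h) _; rewrite -(real_normK (num_real h)) expr2 mulrA.
  rewrite ler_pM2r//; apply: le_trans (_ : (`|C| + 1) * `|h| <= _); last first.
    by rewrite mulrC -ler_pdivlMr ?ltW// ltr_wpDl.
  by rewrite ler_pM2r//; have := ler_norm C; lra.
by split; [apply/cvg_ex; exists df|exact: cvg_lim].
Qed.

Definition pos_sqr t := Num.max t 0 ^+ 2.

Lemma is_derive_pos_sqr a t :
  is_derive t 1 (fun s => pos_sqr (s - a)) (2 * Num.max (t - a) 0).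
Proof.
apply: (@is_derive_quadratic_error _ _ _ 1) => h; rewrite /pos_sqr mul1r.
rewrite ler_norml; apply/andP.
rewrite (_ : t + h - a = t - a + h); last by lra.
move: (t - a) => x; have h2 := sqr_ge0 h; have xh2 := sqr_ge0 (x + h).
case: (leP (x + h) 0) => xh; case: (leP x 0) => x0.
- by split; lra.
- have := mulr_ge0 (ltW x0) (_ : 0 <= - (x + h)).
  by rewrite oppr_ge0 => /(_ xh) ?; split; nra.
- have : 0 <= - x * (h + (x + h)) by apply: mulr_ge0; lra.
  by move=> ?; split; lra.
- by split; lra.
Qed.

(** A C^1 function that is 0 on the left of 0 and 1 on the right of [c]; its
    derivative is the trapezoid of height 1 / (c - d) that grows on [0, d] and
    decreases on [c - d, c]. *)
Definition ramp c d t :=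
  (pos_sqr (t - 0) - pos_sqr (t - d) - (pos_sqr (t - (c - d)) - pos_sqr (t - c)))
  * (2 * d * (c - d))^-1.

Definition dramp c d t :=
  (Num.max (t - 0) 0 - Num.max (t - d) 0
   - (Num.max (t - (c - d)) 0 - Num.max (t - c) 0)) * (d * (c - d))^-1.

(** It climbs by 1 on each interval [j r, j r + c] and is flat in between, so
    that a displacement by [r] never gains more than one climb. *)
Definition staircase c d r n t := \sum_(j < n) ramp c d (t - j%:R * r).

Definition dstaircase c d r n t := \sum_(j < n) dramp c d (t - j%:R * r).

Variables (c d r : R).
Hypotheses (d_gt0 : 0 < d) (dc : 2 * d < c) (cr : c <= r).

Let cd0 : 0 < c - d. Proof. by move: d_gt0 dc => ? ?; lra. Qed.

Lemma is_derive_ramp a t :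
  is_derive t 1 (fun s => ramp c d (s - a)) (dramp c d (t - a)).
Proof.
have H b : is_derive t 1 (fun s => pos_sqr (s - a - b)) (2 * Num.max (t - a - b) 0).
  rewrite (_ : (fun s => _) = fun s => pos_sqr (s - (a + b))); last first.
    by apply/funext => s; rewrite opprD addrA.
  by rewrite -addrA -opprD; exact: is_derive_pos_sqr.
have H1 := is_deriveB (is_deriveB (H 0) (H d)) (is_deriveB (H (c - d)) (H c)).
have H2 := is_deriveZ (2 * d * (c - d))^-1 H1.
have E : (fun s => ramp c d (s - a)) = (2 * d * (c - d))^-1 *:
    (((fun s => pos_sqr (s - a - 0)) - (fun s => pos_sqr (s - a - d))) -
     ((fun s => pos_sqr (s - a - (c - d))) - (fun s => pos_sqr (s - a - c)))).
  by apply/funext => s; rewrite /ramp mulrC.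
rewrite E; apply: is_derive_eq H2 _.
rewrite /dramp /GRing.scale/=; field.
by rewrite !lt0r_neq0.
Qed.

Lemma dramp_ge0 t : 0 <= dramp c d t.
Proof.
have := dc; move: d_gt0 => ? ?.
rewrite /dramp divr_ge0//; last by rewrite mulr_ge0// ltW.
by case: (leP (t - 0) 0) => ?; case: (leP (t - d) 0) => ?;
  case: (leP (t - (c - d)) 0) => ?; case: (leP (t - c) 0) => ?; lra.
Qed.

Lemma dramp_le t : dramp c d t <= (c - d)^-1.
Proof.
have := dc; move: d_gt0 => ? ?.
rewrite /dramp invfM mulrA ler_piMl ?invr_ge0 ?(ltW cd0)//.
rewrite ler_pdivrMr// mul1r.
by case: (leP (t - 0) 0) => ?; case: (leP (t - d) 0) => ?;
  case: (leP (t - (c - d)) 0) => ?; case: (leP (t - c) 0) => ?; lra.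
Qed.

Lemma dramp_eq0 t : t <= 0 \/ c <= t -> dramp c d t = 0.
Proof.
move: d_gt0 dc => ? ? t0; rewrite /dramp [X in X * _](_ : _ = 0) ?mul0r//.
by case: (leP (t - 0) 0) => ?; case: (leP (t - d) 0) => ?;
  case: (leP (t - (c - d)) 0) => ?; case: (leP (t - c) 0) => ?; lra.
Qed.

Lemma ramp_eq0 t : t <= 0 -> ramp c d t = 0.
Proof.
move: d_gt0 dc => ? ? t0; by rewrite /ramp /pos_sqr !max_r ?expr0n ?subrr ?mul0r//; lra.
Qed.

Lemma ramp_eq1 t : c <= t -> ramp c d t = 1.
Proof.
move: d_gt0 dc => ? ? ct; rewrite /ramp /pos_sqr !max_l; [|lra..].
by field; rewrite !lt0r_neq0.
Qed.

(** The derivative is nonnegative. *)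
Lemma ramp_nondecreasing s t : s <= t -> ramp c d s <= ramp c d t.
Proof.
rewrite le_eqVlt => /predU1P[->//|st].
pose f (x : R) : R := ramp c d (x - 0).
have df (x : R) : is_derive x 1 f (dramp c d (x - 0)) by exact: is_derive_ramp.
suff : {in `[s, t] &, {homo f : x y / x <= y}}.
  move=> /(_ s t); rewrite /f !subr0; apply; rewrite ?in_itv/= ?lexx ?ltW//.
apply: ger0_derive1_le_cc.
- by move=> x _; exact: ex_derive.
- by move=> x _; rewrite derive1E derive_val dramp_ge0.
- apply: continuous_subspaceT => x; apply: differentiable_continuous.
  by apply/derivable1_diffP; exact: ex_derive.
Qed.

Lemma ramp_ge0 t : 0 <= ramp c d t.
Proof.
have [t0|t0] := leP t 0; first by rewrite ramp_eq0.
by rewrite -(@ramp_eq0 0)// ramp_nondecreasing// ltW.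
Qed.

Lemma ramp_le1 t : ramp c d t <= 1.
Proof.
have [ct|ct] := leP c t; first by rewrite ramp_eq1.
by rewrite -(@ramp_eq1 c)// ramp_nondecreasing// ltW.
Qed.

Lemma is_derive_staircase n t :
  is_derive t 1 (staircase c d r n) (dstaircase c d r n t).
Proof.
elim: n => [|n IH].
  rewrite (_ : staircase c d r 0 = cst 0); last by apply/funext => s; exact: big_ord0.
  rewrite /dstaircase big_ord0; exact: is_derive_cst.
rewrite (_ : staircase c d r n.+1 =
    staircase c d r n + (fun s => ramp c d (s - n%:R * r))); last first.
  by apply/funext => s; rewrite /staircase big_ord_recr.
rewrite /dstaircase big_ord_recr/=; apply: is_deriveD => //.
exact: is_derive_ramp.
Qed.

Lemma staircase_nondecreasing n s t :
  s <= t -> staircase c d r n s <= staircase c d r n t.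
Proof. by move=> st; apply: ler_sum => j _; rewrite ramp_nondecreasing// lerD2r. Qed.

Lemma staircase_eq0 n t : t <= 0 -> staircase c d r n t = 0.
Proof.
move: d_gt0 dc cr => ? ? ? t0; apply: big1 => j _; apply: ramp_eq0.
by have := mulr_ge0 (ler0n R j) (_ : 0 <= r); lra.
Qed.

Lemma staircase_top n t :
  n%:R * r + c <= t -> staircase c d r n.+1 t = n.+1%:R.
Proof.
move: d_gt0 dc cr => ? ? ? nt; rewrite /staircase (eq_bigr (fun=> 1)); last first.
  move=> j _; apply: ramp_eq1; have jn : (j%:R : R) <= n%:R by rewrite ler_nat -ltnS.
  have := @ler_wpM2r _ r _ _ _ jn; lra.
by rewrite sumr_const card_ord.
Qed.

(** Sliding by [r] maps every ramp onto its neighbour, so only one ramp is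
    gained. *)
Lemma staircase_shift n t :
  staircase c d r n (t + r) <= staircase c d r n t + 1.
Proof.
case: n => [|n]; first by rewrite /staircase !big_ord0 add0r ler01.
rewrite {1}/staircase big_ord_recl addrC; apply: lerD; last exact: ramp_le1.
rewrite /staircase big_ord_recr/=; apply: ler_wpDr; first exact: ramp_ge0.
rewrite le_eqVlt; apply/orP; left; apply/eqP; apply: eq_bigr => j _.
by congr (ramp c d _); rewrite /bump/= add1n -natr1; lra.
Qed.

Lemma staircase_jump n s t :
  `|s - t| <= r -> `|staircase c d r n s - staircase c d r n t| <= 1.
Proof.
wlog st : s t / t <= s => [H|].
  by case: (leP t s) => [/H//|/ltW /H]; rewrite distrC (distrC (staircase _ _ _ _ _)).
rewrite ger0_norm ?subr_ge0// => sr.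
rewrite ger0_norm ?subr_ge0 ?staircase_nondecreasing//.
have := @staircase_nondecreasing n s (t + r); have := staircase_shift n t.
by move=> ? /(_ _); rewrite -lerBlDl => /(_ sr); lra.
Qed.

Lemma dstaircase_ge0 n t : 0 <= dstaircase c d r n t.
Proof. by apply: sumr_ge0 => j _; exact: dramp_ge0. Qed.

Lemma dstaircase_eq0 n t : t <= 0 -> dstaircase c d r n t = 0.
Proof.
move: d_gt0 dc cr => ? ? ? t0; apply: big1 => j _; apply: dramp_eq0; left.
by have := mulr_ge0 (ler0n R j) (_ : 0 <= r); lra.
Qed.

(** The climbs take place on disjoint intervals, so at most one term of the sum
    is nonzero. *)
Lemma dstaircase_le n t : dstaircase c d r n t <= (c - d)^-1.
Proof.
have r0 : 0 < r by move: d_gt0 dc cr => ? ? ?; lra.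
elim: n => [|n IH]; first by rewrite /dstaircase big_ord0 invr_ge0 ltW.
rewrite /dstaircase big_ord_recr/=; have [tn|tn] := leP t (n%:R * r).
  by rewrite (@dramp_eq0 (t - _)) ?addr0//; left; rewrite subr_le0.
rewrite big1 ?add0r; first exact: dramp_le.
move=> j _; apply: dramp_eq0; right.
have jn : (j.+1%:R : R) <= n%:R by rewrite ler_nat.
by have := @ler_wpM2r _ r (ltW r0) _ _ jn; rewrite -natr1 mulrDl mul1r; move: cr => ? ?; lra.
Qed.

Lemma continuous_dstaircase n : continuous (dstaircase c d r n).
Proof.
have cm a : continuous (fun t : R => Num.max (t - a) 0).
  have ca : continuous (fun t : R => t - a).
    by move=> t; apply: cvgB; [exact: cvg_id|exact: cvg_cst].
  by move=> t; apply: (continuous_max (ca t)); exact: cvg_cst.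
have cd : continuous (dramp c d).
  move=> t; apply: cvgM; last exact: cvg_cst.
  by apply: cvgB; apply: cvgB; exact: cm.
apply: continuous_sum => j.
apply: (@continuous_compose _ _ _ (fun t => t - j%:R * r) (dramp c d)) => // t.
by apply: cvgB; [exact: cvg_id|exact: cvg_cst].
Qed.

End staircase.
(** * The integral of a partial derivative *)

Section integral_partial.
Context {R : realType}.
Local Notation lambda := (@lebesgue_measure R).

(** A directional derivative depends only on the restriction to a line; this
    transports it to slices, translates and functions of one variable. *)
Lemma is_derive_along (U V : normedModType R) (x v : U) (y w : V)
    (f : U -> R) (g : V -> R) (df : R) :
  (forall h : R, g (h *: w + y) = f (h *: v + x)) ->
  is_derive x v f df -> is_derive y w g df.
Proof.
move=> fg [dx vx].
have E : (fun h : R => h^-1 *: (g (h *: w + y) - g y)) =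
         (fun h : R => h^-1 *: (f (h *: v + x) - f x)).
  apply/funext => h; rewrite fg; congr (_ *: (_ - _)).
  by have := fg 0; rewrite !scale0r !add0r.
split; first by rewrite /derivable/= E.
by rewrite /derive/= E.
Qed.

(** The fundamental theorem of calculus on an interval containing the
    support. *)
Lemma integral_derive_eq0 (F f : R -> R) (M : R) : 0 < M ->
  continuous f -> (forall t : R, is_derive t 1 F (f t)) ->
  (forall t, M < `|t| -> F t = 0 /\ f t = 0) ->
  (\int[lambda]_t (f t)%:E = 0)%E.
Proof.
move=> M0 cf dF F0; pose b := M + 1.
have b0 : - b < b by rewrite /b; lra.
have Fb : F b = 0 by apply: (F0 _ _).1; rewrite ger0_norm /b; lra.
have FNb : F (- b) = 0 by apply: (F0 _ _).1; rewrite normrN ger0_norm /b; lra.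
have cF : continuous F.
  move=> t; apply: differentiable_continuous; apply/derivable1_diffP.
  exact: ex_derive.
transitivity (\int[lambda]_(t in `[(- b)%R, b]) (f t)%:E)%E.
  rewrite [RHS]integral_mkcond; apply: eq_integral => t _; rewrite patchE.
  case: ifPn => // /negP tb; congr (_%:E); apply: (F0 _ _).2.
  rewrite ltNge; apply/negP; rewrite ler_norml => /andP[? ?]; apply: tb.
  by rewrite inE /= in_itv/=; apply/andP; split; rewrite /b; lra.
rewrite (@continuous_FTC2 _ f F)//.
- by rewrite Fb FNb subee.
- exact: continuous_subspaceT.
- split; first by move=> t _; exact: ex_derive.
  + by apply: cvg_at_right_filter; exact: cF.
  + by apply: cvg_at_left_filter; exact: cF.
- by move=> t _; rewrite derive1E derive_val.
Qed.

Lemma compact_cube n (c : 'rV[R]_n) e : compact (cube c e).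
Proof.
have -> : cube c e = [set v : 'rV[R]_n |
    forall i, `[c ord0 i - e, c ord0 i + e]%classic (v ord0 i)].
  apply/seteqP; split => x /= H i; first by rewrite in_itv/=; exact: H.
  by have := H i; rewrite in_itv.
apply: (@rV_compact R n (fun i => `[c ord0 i - e, c ord0 i + e]%classic)) => i.
exact: segment_compact.
Qed.

Lemma bounded_of_cube n (f : 'rV[R]_n -> R) e : continuous f ->
  (forall x, ~ cube 0 e x -> f x = 0) -> exists C, forall x, `|f x| <= C.
Proof.
move=> cf f0.
have : compact (f @` cube (0 : 'rV[R]_n) e).
  by apply: continuous_compact; [exact: continuous_subspaceT|exact: compact_cube].
move=> /compact_bounded[C [_ /(_ (`|C| + 1))]].
rewrite (le_lt_trans (ler_norm _)) ?ltrDl// => /(_ isT) fC.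
exists (`|C| + 1) => x; have [xe|/f0 ->] := pselect (cube 0 e x).
  by apply: fC; exists x.
by rewrite normr0 addr_ge0.
Qed.

Lemma integrable_of_finite_support d (T : measurableType d)
    (mu : {measure set T -> \bar R}) (A : set T) (f : T -> R) (C : R) :
  measurable A -> (mu A < +oo)%E -> measurable_fun setT f ->
  (forall x, `|f x| <= C) -> (forall x, ~ A x -> f x = 0) ->
  mu.-integrable setT (EFin \o f).
Proof.
move=> mA muA mf fC f0.
have -> : EFin \o f = (EFin \o f) \_ A.
  apply/funext => x; rewrite patchE; case: ifPn => // /negP xA /=.
  by rewrite f0// => Ax; apply: xA; rewrite inE.
apply/(integrable_mkcond _ mA).1; apply: measurable_bounded_integrable => //.
  exact: measurable_funTS.
exists C; split; first exact: num_real.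
by move=> M CM x _; apply: le_trans (fC x) _; exact: ltW.
Qed.

Lemma leb_sigma_finite n : sigma_finite setT (leb (R := R) n).
Proof.
exists (fun k => cube 0 k.+1%:R).
  apply/esym/seteqP; split => // x _.
  exists (Num.truncn `|x|) => // i; rewrite mxE sub0r add0r -ler_norml.
  apply: ltW; apply: le_lt_trans (truncnS_gt `|x|).
  by move: i; apply/normr_rV_leP.
by move=> k; split; [exact: measurable_cube|rewrite leb_cube// ltry].
Qed.

Section product.
Variable n : nat.

Let H1 := isSigmaFinite.Build _ _ _ (leb n) (@leb_sigma_finite n).
Let H2 := isSFinite.Build _ _ _ (leb n)
  (sfinite_measure_sigma_finite (@leb_sigma_finite n)).

(** [leb n] with the structure that Fubini's theorem asks for. *)
Definition sigma_finite_leb : {sigma_finite_measure set 'rV[R]_n -> \bar R} :=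
  HB.pack_for (SigmaFiniteMeasure.type 'rV[R]_n R) (Measure.sort (leb n)) H1 H2.

Variables (f : 'rV[R]_n.+1 -> R) (M : R).
Hypotheses (M_gt0 : 0 < M) (cf : continuous f)
  (f_cube : forall x, ~ cube 0 M x -> f x = 0).

Lemma integrable_comp_cons :
  (sigma_finite_leb \x lambda)%E.-integrable setT (EFin \o (f \o @rV_cons R n)).
Proof.
have [C fC] := bounded_of_cube cf f_cube.
apply: (@integrable_of_finite_support _ _ _ (@rV_cons R n @^-1` cube 0 M) _ C).
- rewrite -[X in measurable X]setTI; apply: measurable_rV_cons => //.
  exact: measurable_cube.
- by have := @leb_cube R n.+1 0 M M_gt0; rewrite /= /leb_cons /pushforward => ->;
    rewrite ltry.
- apply: measurableT_comp; last exact: measurable_rV_cons.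
  exact: continuous_measurable.
- by move=> x; exact: fC.
- by move=> x; exact: f_cube.
Qed.

Lemma integral_lebS : (\int[leb n.+1]_x (f x)%:E =
  \int[sigma_finite_leb \x lambda]_p (f (rV_cons p))%:E)%E.
Proof.
have := @integral_pushforward _ _ _ _ _ _ (@measurable_rV_cons R n)
  (sigma_finite_leb \x lambda)%E setT (EFin \o f).
rewrite preimage_setT; apply => //.
  by apply/measurable_EFinP; exact: continuous_measurable.
exact: integrable_comp_cons.
Qed.

Lemma integral_lebS_cons : (\int[leb n.+1]_x (f x)%:E =
  \int[leb n]_y \int[lambda]_t (f (rV_cons (y, t)))%:E)%E.
Proof. by rewrite integral_lebS -(integral12_prod_meas1 integrable_comp_cons). Qed.

Lemma integral_lebS_snoc : (\int[leb n.+1]_x (f x)%:E =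
  \int[lambda]_t \int[leb n]_y (f (rV_cons (y, t)))%:E)%E.
Proof. by rewrite integral_lebS -(integral21_prod_meas1 integrable_comp_cons). Qed.

End product.
End integral_partial.
(** * Continuously differentiable functions have a weak gradient *)

Section weak_gradient.
Context {R : realType}.
Local Notation lambda := (@lebesgue_measure R).

Lemma rV_consP n (x : 'rV[R]_n.+1) (p : 'rV[R]_n * measurableTypeR R) :
  p.2 = x ord0 ord0 -> (forall i, p.1 ord0 i = x ord0 (lift ord0 i)) ->
  rV_cons p = x.
Proof.
move=> p2 p1; apply/rowP => i; case: (unliftP ord0 i) => [j|] ->.
  by rewrite rV_consS.
by rewrite rV_cons0.
Qed.

Lemma continuous_rV_cons n (T : topologicalType) (y : T -> 'rV[R]_n) (t : T -> R) :
  continuous y -> continuous t ->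
  continuous (fun s => @rV_cons R n (y s, t s) : 'rV[R]_n.+1).
Proof.
move=> cy ct; apply: continuous_rV => i; case: (unliftP ord0 i) => [j|] ->.
  rewrite (_ : (fun _ => _) = fun s => y s ord0 j); last first.
    by apply/funext => s; rewrite rV_consS.
  exact: (continuous_compose cy (@coord_continuous _ _ _ ord0 j)).
rewrite (_ : (fun _ => _) = t)//.
by apply/funext => s; rewrite rV_cons0.
Qed.

Let coord_line n (h : R) (i : 'I_n) (x : 'rV[R]_n) k :
  (h *: delta_mx ord0 i + x) ord0 k = h * (k == i)%:R + x ord0 k.
Proof. by rewrite !mxE eqxx. Qed.

(** Induction on the dimension. The derivative in the first coordinate is
    integrated in that coordinate first; a derivative in another coordinate
    is integrated over the slices where the first coordinate is fixed, which
    have one dimension less. *)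
Lemma integral_partial_eq0 n (i : 'I_n) (psi dpsi : 'rV[R]_n -> R) (M : R) :
  0 < M -> continuous dpsi ->
  (forall x : 'rV[R]_n, is_derive x (delta_mx ord0 i) psi (dpsi x)) ->
  (forall x, ~ cube 0 M x -> psi x = 0 /\ dpsi x = 0) ->
  (\int[leb n]_x (dpsi x)%:E = 0)%E.
Proof.
elim: n i psi dpsi => [[]//|n IH] i psi dpsi M0 cd dpsiP out.
have out2 x : ~ cube 0 M x -> dpsi x = 0 by move=> /out[].
case: (unliftP ord0 i) dpsiP => [j|] -> dpsiP.
  rewrite (integral_lebS_snoc M0 cd out2); apply: integral0_eq => t _.
  apply: (IH j (fun y => psi (rV_cons (y, t)))) => //.
  - apply: continuous_compose cd; apply: continuous_rV_cons.
      by move=> z; exact: cvg_id.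
    exact: (@cst_continuous _ R t).
  - move=> y; apply: is_derive_along (dpsiP (rV_cons (y, t))) => h.
    congr (psi _); apply: rV_consP => [|k] /=; rewrite !coord_line.
      by rewrite rV_cons0/= mulr0 add0r.
    by rewrite rV_consS (inj_eq lift_inj).
  - move=> y yM; apply: out => yt; apply: yM => k.
    by have := yt (lift ord0 k); rewrite rV_consS !mxE.
rewrite (integral_lebS_cons M0 cd out2); apply: integral0_eq => y _.
apply: (@integral_derive_eq0 _ (fun t => psi (rV_cons (y, t))) _ _ M0).
- apply: continuous_compose cd; apply: continuous_rV_cons.
    exact: (@cst_continuous R _ y).
  by move=> t; exact: cvg_id.
- move=> t; apply: is_derive_along (dpsiP (rV_cons (y, t))) => h.
  congr (psi _); apply: rV_consP => [|k] /=; rewrite !coord_line.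
    by rewrite rV_cons0.
  by rewrite rV_consS/= mulr0 add0r.
- move=> t Mt; apply: out => /(_ ord0); rewrite rV_cons0 !mxE sub0r add0r.
  by rewrite -ler_norml leNgt Mt.
Qed.

(** By the product rule, [u * partial i phi + g_i * phi] is a partial derivative
    of [u * phi], whose integral vanishes. *)
Lemma weak_gradient_of_C1 N (Omega : set 'rV[R]_N) (u : 'rV[R]_N -> R)
    (g : 'rV[R]_N -> 'rV[R]_N) (M : R) :
  0 < M -> continuous u -> (forall i, continuous (fun x => g x ord0 i)) ->
  (forall (x : 'rV[R]_N) i, is_derive x (delta_mx ord0 i) u (g x ord0 i)) ->
  (forall x, ~ cube 0 M x -> u x = 0 /\ g x = 0) ->
  (forall x, ~ Omega x -> u x = 0 /\ g x = 0) ->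
  weak_gradient Omega u g.
Proof.
move=> M0 cu cg gP out outO phi [ckphi _ _] i.
have cphi : continuous phi by exact: (ckphi 0).
have [dphi cdphi] := ckphi 1.
pose a x := u x * partial i phi x; pose b x := g x ord0 i * phi x.
have ca : continuous a by apply: continuous_mul => //; exact: cdphi.
have cb : continuous b by exact: continuous_mul.
have restr (f : 'rV[R]_N -> R) : (forall x, ~ Omega x -> f x = 0) -> f \_ Omega = f.
  move=> f0; apply/funext => x; rewrite patchE; case: ifPn => // /negP xO.
  by rewrite f0// => Ox; apply: xO; rewrite inE.
have a0 x : ~ Omega x -> a x = 0 by move=> /outO[+ _]; rewrite /a => ->; rewrite mul0r.
have b0 x : ~ Omega x -> b x = 0.
  by move=> /outO[_ +]; rewrite /b => ->; rewrite mxE mul0r.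
rewrite -/(Rintegral _ _ a) Rintegral_mkcond (restr a a0).
rewrite -/(Rintegral _ _ b) [in RHS]Rintegral_mkcond (restr b b0).
have int (f : 'rV[R]_N -> R) : continuous f -> (forall x, ~ cube 0 M x -> f x = 0) ->
    (leb N).-integrable setT (EFin \o f).
  move=> cf f0; have [C fC] := bounded_of_cube cf f0.
  apply: (integrable_of_finite_support (measurable_cube 0 M) _ _ fC f0).
    by rewrite [X in (X < _)%E](_ : _ = leb N (cube 0 M))// leb_cube// ltry.
  exact: continuous_measurable.
have ia : (leb N).-integrable setT (EFin \o a).
  by apply: int => // x /out[+ _]; rewrite /a => ->; rewrite mul0r.
have ib : (leb N).-integrable setT (EFin \o b).
  by apply: int => // x /out[_ +]; rewrite /b => ->; rewrite mxE mul0r.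
apply/eqP; rewrite -addr_eq0 -RintegralD//; apply/eqP.
rewrite /Rintegral [X in fine X](_ : _ = 0%E)//.
apply: (@integral_partial_eq0 _ i (u * phi) (fun x => a x + b x) M) => //.
- exact: continuous_add.
- move=> x; have Dphi : is_derive x (delta_mx ord0 i) phi (partial i phi x).
    by apply: DeriveDef => //; apply: diff_derivable; exact: dphi.
  apply: is_derive_eq (is_deriveM (gP x i) Dphi) _.
  by rewrite /a /b /GRing.scale/= [phi x * _]mulrC.
- move=> x /out[u0 g0].
  by rewrite /a /b /= g0 mxE; split; [rewrite /GRing.mul/= u0 mul0r|rewrite u0 !mul0r addr0].
Qed.

End weak_gradient.
(** * The jump seminorm *)

Section jump.
Context {R : realType} {N : nat}.
Implicit Types (u : 'rV[R]_N -> R) (x y z v : 'rV[R]_N).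

Variable J : 'rV[R]_N -> R.
Hypothesis hJ : admissible_kernel J.
Local Notation r := (kernel_radius J).

Lemma tsupp_kernel_lt x : enorm x < r -> tsupp J x.
Proof.
by move=> xr; apply: subset_closure => /=; rewrite gt_eqF// (kernel_gt0 hJ).
Qed.

(** The positivity of the radius excludes that the infimum defining it is taken
    over the empty set. *)
Lemma tsupp_kernel_le x : 0 < r -> tsupp J x -> enorm x <= r.
Proof.
move=> r0; apply: closure_enorm_le => {}x /= /eqP Jx; apply: lb_le_inf.
  apply/set0P/negP => /eqP E0.
  by move: r0; rewrite /kernel_radius E0 inf0 ltxx.
move=> s sP; rewrite leNgt; apply/negP => sx; apply/Jx/sP.
by rewrite /eball/= subr0 => /ltW; rewrite leNgt sx.
Qed.

Section bounded_function.
Variables (u : 'rV[R]_N -> R) (C : R).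
Hypothesis uC : forall x, `|u x| <= C.

Lemma le_jump_seminorm x y : tsupp J (x - y) -> `|u x - u y| <= jump_seminorm J u.
Proof.
move=> xy; apply: sup_upper_bound; last by exists x, y.
split; first by exists `|u x - u y|, x, y.
exists (C + C) => _ [x' [y' [_ ->]]].
by rewrite (le_trans (ler_normB _ _))// lerD.
Qed.

(** One jump per step. *)
Lemma walk_le_jump_seminorm n x v : enorm v < r ->
  `|u (x + n%:R *: v) - u x| <= n%:R * jump_seminorm J u.
Proof.
move=> vr; elim: n => [|n IH]; first by rewrite scale0r addr0 subrr normr0 mul0r.
have step : `|u (x + n.+1%:R *: v) - u (x + n%:R *: v)| <= jump_seminorm J u.
  apply: le_jump_seminorm; apply: tsupp_kernel_lt.
  by rewrite -natr1 scalerDl scale1r opprD addrACA subrr add0r addrAC subrr add0r.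
rewrite -[X in `|X|](subrKA (u (x + n%:R *: v))).
rewrite (le_trans (ler_normD _ _))// -natr1 mulrDl mul1r addrC lerD//.
by rewrite natr1.
Qed.

Lemma le_jump_seminorm_of_dist n x z : (0 < n)%N -> enorm (z - x) < n%:R * r ->
  `|u z - u x| <= n%:R * jump_seminorm J u.
Proof.
move=> n0 zx; have np : 0 < n%:R :> R by rewrite ltr0n.
have := @walk_le_jump_seminorm n x (n%:R^-1 *: (z - x)).
rewrite scalerA divff ?gt_eqF// scale1r (_ : x + (z - x) = z); last by rewrite addrC subrK.
apply.
by rewrite enormZ ger0_norm ?invr_ge0 ?ltW// mulrC ltr_pdivrMr// mulrC.
Qed.

End bounded_function.

(** Every point of [Omega] reaches the zero set of [u] in [n] jumps, so [|u|]
    is at most [n] times the jump seminorm. The supremum norm is positive,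
    and the quotient therefore genuine, by continuity of [u]. *)
Lemma quotient_lower_bound (Omega : set 'rV[R]_N) u g n : 0 < r -> (0 < n)%N ->
  open Omega ->
  (forall x, Omega x -> exists2 z, ~ Omega z & enorm (z - x) < n%:R * r) ->
  W1infty0_grad Omega u g -> (exists x, u x != 0) ->
  n%:R^-1 <= Num.max (fine (Linfty_norm Omega (enorm \o g))) (jump_seminorm J u)
             / fine (Linfty_norm Omega u).
Proof.
move=> r0 n0 oO reach [[[_ Lfin] _ _] cu u0] [x0 ux0].
have Ox0 : Omega x0 by apply: contrapT => /u0 /eqP; rewrite (negbTE ux0).
have uL x : Omega x -> (`|u x|%:E <= Linfty_norm Omega u)%E.
  exact: normr_le_Linfty_norm.
have Lnum : Linfty_norm Omega u \is a fin_num.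
  rewrite ge0_fin_numE//; apply: le_trans (uL _ Ox0); by rewrite lee_fin.
pose L := fine (Linfty_norm Omega u); rewrite -/L.
have LE : Linfty_norm Omega u = L%:E by rewrite fineK.
have {}uL x : `|u x| <= L.
  have [Ox|nOx] := pselect (Omega x); first by rewrite -lee_fin -LE uL.
  rewrite u0// normr0; apply: le_trans (_ : `|u x0| <= _) => //.
  by rewrite -lee_fin -LE uL.
have L0 : 0 < L by apply: lt_le_trans (uL x0); rewrite normr_gt0.
have np : 0 < n%:R :> R by rewrite ltr0n.
have ju0 : 0 <= jump_seminorm J u.
  have := @le_jump_seminorm u L uL 0 0; rewrite !subrr normr0; apply.
  by apply: tsupp_kernel_lt; rewrite enorm0.
have : L <= n%:R * jump_seminorm J u.
  rewrite -lee_fin -LE; apply: Linfty_norm_le => x.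
  have [/reach[z nOz zx]|nOx] := pselect (Omega x); last first.
    by rewrite u0// normr0 mulr_ge0// ltW.
  by have := le_jump_seminorm_of_dist uL n0 zx; rewrite u0// sub0r normrN.
move=> Lj; rewrite ler_pdivlMr// ler_pdivrMl//; apply: le_trans Lj _.
by rewrite ler_pM2l// le_max lexx orbT.
Qed.

End jump.

(** * Radial test functions *)

Section radial.
Context {R : realType} {N : nat}.
Implicit Types (x y : 'rV[R]_N) (eta : R).

(** Chain rule for directional derivatives, from the one-dimensional one. *)
Lemma is_derive_comp_along (V : normedModType R) (x v : V) (f : V -> R)
    (F : R -> R) (df dF : R) :
  is_derive x v f df -> is_derive (f x) 1 F dF ->
  is_derive x v (F \o f) (dF * df).
Proof.
move=> fx Fx.
pose l h := f (h *: v + x).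
have l0 : l 0 = f x by rewrite /l scale0r add0r.
have lx : is_derive (0 : R) 1 l df.
  by apply: is_derive_along fx => h; rewrite /l addr0 /GRing.scale/= mulr1.
have Fl : is_derive (l 0) 1 F dF by rewrite l0.
apply: is_derive_along (is_derive1_comp Fl lx) => h.
by rewrite /l /= addr0 [in RHS]/GRing.scale/= mulr1.
Qed.

Lemma is_derive_smooth_norm eta x i : 0 < eta ->
  is_derive x (delta_mx ord0 i) (smooth_norm eta) (x ord0 i / smooth_norm eta x).
Proof.
move=> eta0.
pose q x := edot x x + eta ^+ 2.
have qx : is_derive x (delta_mx ord0 i) q (2 * x ord0 i).
  pose p (h : R) : R := q x + h * (2 * x ord0 i) + h ^+ 2.
  have pD : is_derive (0 : R) 1 p (2 * x ord0 i).
    apply: (@is_derive_quadratic_error _ _ _ _ 1) => h.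
    rewrite /p add0r mul1r !mul0r expr0n !addr0.
    by rewrite (_ : _ - _ = h ^+ 2) ?ger0_norm ?sqr_ge0//; ring.
  apply: is_derive_along pD => h; rewrite addr0 [in RHS]/GRing.scale/= mulr1.
  rewrite /p /q !(edotDl, edotDr, edotZl, edotZr) !edot_delta.
  by rewrite (edotC (delta_mx _ _) x) edot_delta mxE !eqxx/=; ring.
have q0 : 0 < q x by rewrite /q ltr_wpDl ?edot_ge0 ?exprn_gt0.
have := is_derive_comp_along qx (is_derive1_sqrt q0).
move=> H; apply: is_derive_eq H _.
by rewrite -/(smooth_norm eta x); field; rewrite gt_eqF// smooth_norm_gt0.
Qed.

End radial.
(** * The test function *)

Section test_function.
Context {R : realType} {N : nat}.
Variables (x0 : 'rV[R]_N) (K : nat) (r d : R).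
Hypotheses (r_ge1 : 1 <= r) (d_gt0 : 0 < d) (d_small : 3 * d < 1).

(* With these values the climbs have slope 1 / (1 - 2 * d), the support has
   radius [theta < K * r + 1], and the last climb ends where the smoothed norm
   is [eta], its value at the centre. *)
Let c := 1 - d.
Let eta := d / 2.
Let theta := K%:R * r + c + eta.
Let k := K.+1%:R^-1 : R.

Definition profile (s : R) := k * staircase c d r K.+1 (theta - s).
Definition dprofile (s : R) := - (k * dstaircase c d r K.+1 (theta - s)).

Definition bump (x : 'rV[R]_N) := profile (smooth_norm eta (x - x0)).
Definition grad_bump (x : 'rV[R]_N) :=
  (dprofile (smooth_norm eta (x - x0)) / smooth_norm eta (x - x0)) *: (x - x0).

Let eta0 : 0 < eta. Proof. by rewrite divr_gt0. Qed.
Let dc : 2 * d < c. Proof. by move: d_small; rewrite /c => ?; lra. Qed.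
Let cr : c <= r. Proof. by move: d_gt0 r_ge1; rewrite /c => ? ?; lra. Qed.
Let k0 : 0 < k. Proof. by rewrite invr_gt0. Qed.

Lemma is_derive_profile (s : R) : is_derive s 1 profile (dprofile s).
Proof.
have aD : is_derive s 1 (fun t : R => theta - t) (-1).
  apply: (@is_derive_quadratic_error _ _ _ _ 0) => h.
  by rewrite (_ : _ - _ = 0) ?normr0 ?mul0r//; lra.
have := @is_derive1_comp _ (staircase c d r K.+1) (fun t => theta - t) _ _ _
  (is_derive_staircase r d_gt0 dc K.+1 (theta - s)) aD.
move=> /(is_deriveZ k) H; apply: is_derive_eq H _.
by rewrite /dprofile /GRing.scale/= mulrN1 mulrN.
Qed.

Let continuous_shift : continuous (fun x : 'rV[R]_N => x - x0 : 'rV[R]_N).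
Proof.
apply: continuous_rV => i.
rewrite (_ : (fun _ => _) = fun x : 'rV[R]_N => x ord0 i - x0 ord0 i); last first.
  by apply/funext => x; rewrite !mxE.
apply: continuous_add; first exact: (@coord_continuous _ _ _ ord0 i).
exact: (@cst_continuous _ R (- x0 ord0 i)).
Qed.

Let continuous_norm : continuous (fun x : 'rV[R]_N => smooth_norm eta (x - x0)).
Proof. exact: continuous_compose continuous_shift (@continuous_smooth_norm _ _ eta). Qed.

Lemma continuous_bump : continuous bump.
Proof.
apply: continuous_compose continuous_norm _ => s.
apply: differentiable_continuous; apply/derivable1_diffP.
by have := is_derive_profile s => ?; exact: ex_derive.
Qed.

Lemma continuous_grad_bump i : continuous (fun x => grad_bump x ord0 i).
Proof.
rewrite (_ : (fun _ => _) = fun x =>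
    (dprofile (smooth_norm eta (x - x0)) * (smooth_norm eta (x - x0))^-1) *
    (x - x0) ord0 i); last by apply/funext => x; rewrite mxE.
apply: continuous_mul; [apply: continuous_mul|].
- apply: continuous_compose continuous_norm _ => s.
  apply: cvgN; apply: cvgM; first exact: cvg_cst.
  have cs : continuous (fun t : R => theta - t).
    by move=> t; apply: cvgB; [exact: cvg_cst|exact: cvg_id].
  exact: (continuous_compose cs (@continuous_dstaircase R c d r K.+1)).
- move=> x; have n0 : smooth_norm eta (x - x0) != 0.
    by rewrite gt_eqF// smooth_norm_gt0.
  exact: (cvgV n0 (@continuous_norm x)).
- exact: (continuous_compose continuous_shift (@coord_continuous _ _ _ ord0 i)).
Qed.

Lemma is_derive_bump (x : 'rV[R]_N) i :
  is_derive x (delta_mx ord0 i) bump (grad_bump x ord0 i).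
Proof.
have nD : is_derive x (delta_mx ord0 i) (fun y => smooth_norm eta (y - x0))
    ((x - x0) ord0 i / smooth_norm eta (x - x0)).
  apply: is_derive_along (is_derive_smooth_norm (x - x0) i eta0) => h.
  by rewrite addrA.
have := is_derive_comp_along nD (is_derive_profile _) => H.
apply: is_derive_eq H _.
by rewrite [RHS]mxE mulrA mulrAC.
Qed.

Lemma bump_eq0 x : theta <= enorm (x - x0) -> bump x = 0 /\ grad_bump x = 0.
Proof.
move=> tx; have tn : theta - smooth_norm eta (x - x0) <= 0.
  by rewrite subr_le0 (le_trans tx)// enorm_le_smooth_norm.
rewrite /bump /grad_bump /profile /dprofile.
by rewrite staircase_eq0// dstaircase_eq0// !mulr0 oppr0 mul0r scale0r.
Qed.

Lemma bump_eq0_cube x :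
  ~ cube 0 (enorm x0 + theta) x -> bump x = 0 /\ grad_bump x = 0.
Proof.
move=> xM; apply: bump_eq0; rewrite leNgt; apply/negP => xt; apply: xM => i.
rewrite !mxE sub0r add0r -ler_norml (le_trans (coord_le_enorm _ _))//.
have := enormD (x - x0) x0; rewrite subrK => ?; lra.
Qed.

Lemma bump_center : bump x0 = 1.
Proof.
rewrite /bump /profile subrr smooth_norm_at0 ?ltW// staircase_top//.
  by rewrite /k mulVf// pnatr_eq0.
by rewrite /theta; lra.
Qed.

Lemma enorm_grad_bump x : enorm (grad_bump x) <= k / (1 - 2 * d).
Proof.
have n0 : 0 < smooth_norm eta (x - x0) by exact: smooth_norm_gt0.
rewrite enormZ normrM normfV (ger0_norm (ltW n0)) -mulrA.
rewrite (@le_trans _ _ (`|dprofile (smooth_norm eta (x - x0))| * 1))//.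
  by rewrite ler_wpM2l// mulrC ler_pdivrMr// mul1r enorm_le_smooth_norm.
rewrite mulr1 normrN ger0_norm ?mulr_ge0 ?(ltW k0) ?dstaircase_ge0//.
rewrite ler_pM2l// (_ : 1 - 2 * d = c - d); last by rewrite /c; lra.
exact: dstaircase_le.
Qed.

Lemma bump_jump x y : enorm (x - y) <= r -> `|bump x - bump y| <= k.
Proof.
move=> xy; rewrite -mulrBr normrM (ger0_norm (ltW k0)) ler_piMr ?(ltW k0)//.
apply: staircase_jump => //.
rewrite opprB addrC subrKA distrC.
rewrite (le_trans (smooth_norm_lipschitz _ _ _))//.
by rewrite [X in enorm X](_ : _ = x - y)// opprB addrA subrK.
Qed.

Lemma bump_W1infty0 (Omega : set 'rV[R]_N) :
  (forall x, enorm (x - x0) <= theta -> Omega x) ->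
  W1infty0_grad Omega bump grad_bump.
Proof.
move=> inO; pose M := enorm x0 + theta.
have t0 : 0 < theta.
  rewrite /theta -addrA ltr_wpDl ?mulr_ge0//; first by move: r_ge1 => ?; lra.
  by move: d_small eta0; rewrite /c => ? ?; lra.
have M0 : 0 < M by rewrite /M ltr_wpDl ?enorm_ge0.
have outC := bump_eq0_cube.
have outO x : ~ Omega x -> bump x = 0 /\ grad_bump x = 0.
  move=> xO; apply: bump_eq0; rewrite leNgt; apply/negP => xt; apply/xO/inO.
  exact: ltW.
have fin f : continuous f -> (forall x, ~ cube 0 M x -> f x = 0) -> Linfty Omega f.
  move=> cf f0; split; first exact: measurable_funTS (continuous_measurable cf).
  have [C fC] := bounded_of_cube cf f0.
  by apply: le_lt_trans (Linfty_norm_le Omega fC) _; rewrite ltry.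
split; last 2 first.
- exact: continuous_bump.
- by move=> x /outO[].
split; first by apply: fin continuous_bump _ => x /outC[].
  move=> i; apply: fin (@continuous_grad_bump i) _ => x /outC[_ ->].
  by rewrite mxE.
apply: (@weak_gradient_of_C1 R N Omega bump grad_bump M) => //.
- exact: continuous_bump.
- exact: continuous_grad_bump.
- exact: is_derive_bump.
Qed.

(** The value 1 at the centre bounds the denominator from below; the slope and
    the jumps bound the numerator. *)
Lemma bump_quotient (Omega : set 'rV[R]_N) J :
  admissible_kernel J -> kernel_radius J = r ->
  open Omega -> Omega x0 ->
  Num.max (fine (Linfty_norm Omega (enorm \o grad_bump))) (jump_seminorm J bump)
    / fine (Linfty_norm Omega bump) <= k / (1 - 2 * d).
Proof.
move=> hJ Jr oO Ox0.
have kd0 : 0 <= k / (1 - 2 * d).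
  by rewrite divr_ge0 ?(ltW k0)//; move: d_small => ?; lra.
have [B bumpB] : exists B, forall x, `|bump x| <= B.
  by apply: bounded_of_cube continuous_bump _ => x /bump_eq0_cube[].
have L1 : 1 <= fine (Linfty_norm Omega bump).
  have := normr_le_Linfty_norm oO continuous_bump Ox0.
  rewrite bump_center normr1; have := Linfty_norm_le Omega bumpB.
  by case: (Linfty_norm Omega bump).
have gE : (Linfty_norm Omega (enorm \o grad_bump) <= (k / (1 - 2 * d))%:E)%E.
  apply: Linfty_norm_le => x /=.
  by rewrite ger0_norm ?enorm_ge0// enorm_grad_bump.
have g0 : fine (Linfty_norm Omega (enorm \o grad_bump)) <= k / (1 - 2 * d).
  by case: (Linfty_norm _ _) gE => //= s; rewrite lee_fin.
rewrite ler_pdivrMr ?(lt_le_trans _ L1)//.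
rewrite (@le_trans _ _ (k / (1 - 2 * d)))//; last by rewrite ler_peMr.
rewrite ge_max g0/=; apply: ge_sup.
  exists 0, 0, 0; rewrite !subrr normr0; split => //.
  by apply: (tsupp_kernel_lt hJ); rewrite enorm0 Jr; move: r_ge1 => ?; lra.
move=> _ [x [y [xyJ ->]]]; have xy : enorm (x - y) <= r.
  have J0 : 0 < kernel_radius J by rewrite Jr; move: r_ge1 => ?; lra.
  by rewrite -Jr; exact: tsupp_kernel_le xyJ.
rewrite (le_trans (bump_jump xy))//.
rewrite ler_peMr ?(ltW k0)// invf_ge1; move: d_gt0 d_small => ? ?; lra.
Qed.

End test_function.
Theorem theorem4p2 (R : realType) (N : nat) (alpha : R)
    (Omega : set 'rV[R]_N) (J : 'rV[R]_N -> R) (K : nat) (b : R)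
    (N_gt0 : (0 < N)%N) (alpha_gt0 : 0 < alpha) (alpha_le1 : alpha <= 1)
    (hOmega : bounded_C1alpha_domain alpha Omega)
    (hJ : admissible_kernel J)
    (b_ge0 : 0 <= b) (b_lt : b < kernel_radius J)
    (hKb : inradius Omega = K%:R * kernel_radius J + b)
    (K_gt0 : (0 < K)%N) (b_gt0 : 0 < b) (RJ_gt1 : 1 < kernel_radius J)
    (b_ge1 : 1 <= b) :
  Lambda Omega J = 1 / (K%:R + 1).
Proof.
case: hOmega => O0 oO _ bO _.
set r := kernel_radius J in b_lt hKb RJ_gt1.
have r0 : 0 < r by lra.
rewrite div1r natr1; pose k : R := K.+1%:R^-1.
have k0 : 0 < k by rewrite invr_gt0.
rewrite -/k /Lambda; set Q := (X in inf X).
have lower q : Q q -> k <= q.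
  move=> [u [g [ug unz ->]]]; apply: (quotient_lower_bound hJ) ug unz => //.
  move=> x Ox; apply: near_boundary => //.
  by rewrite hKb -/r -natr1; lra.
have upper (d : R) : 0 < d -> 3 * d < 1 -> exists2 q, Q q & q <= k / (1 - 2 * d).
  move=> d0 d3; have [||x0 Ox0 inO] :=
      @ball_of_inradius _ _ Omega oO bO (K%:R * r + (1 - d) + d / 2) N_gt0 O0.
  - by have := mulr_ge0 (ler0n R K) (ltW r0); lra.
  - by rewrite hKb; lra.
  have := bump_quotient K (ltW RJ_gt1) d0 d3 hJ erefl oO Ox0.
  set q := (X in X <= _) => qd; exists q => //.
  exists (bump x0 K r d), (grad_bump x0 K r d); split => //.
    by apply: bump_W1infty0 => //; exact: ltW.
  by exists x0; rewrite bump_center ?oner_eq0// ltW.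
apply/eqP; rewrite eq_le; apply/andP; split; last first.
  apply: lb_le_inf; last by move=> q; exact: lower.
  by have [||q Qq _] := upper (1 / 4); [lra|lra|exists q].
rewrite leNgt; apply/negP => kL.
(* k / (1 - 2 * d) is still below the infimum for this d *)
pose s := inf Q / k; have s1 : 1 < s by rewrite ltr_pdivlMr// mul1r.
pose d := Num.min (1 / 4) ((s - 1) / (4 * s)).
have s0 : 0 < 4 * s by lra.
have d0 : 0 < d by rewrite lt_min; apply/andP; split; apply: divr_gt0 => //; lra.
have d4 : d <= 1 / 4 by rewrite ge_min lexx.
have ds : d * (4 * s) <= s - 1 by rewrite -ler_pdivlMr// ge_min lexx orbT.
have [||q Qq qd] := upper d; [by []|by lra|].
have : inf Q <= q by apply: ge_inf => //; exists k => ?; exact: lower.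
move=> /le_trans /(_ qd); rewrite leNgt => /negP; apply.
rewrite ltr_pdivrMr; last by lra.
have -> : inf Q = s * k by rewrite divfK// gt_eqF.
by rewrite mulrAC -[ltLHS]mul1r ltr_pM2r//; lra.
Qed.
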